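(* Let $B$ be a finite left brace, let $s\ge 2$, and let $B_1,\dots,B_s$ be left ideals of $B$ of pairwise coprime orders such that $B$ is the iterated matched product of the left ideals $B_1,\dots,B_s$ (that is, $(B,+)$ is the inner direct sum of $(B_1,+),\dots,(B_s,+)$). Assume that every $B_i$ is a simple left brace. Then the left brace $B$ is simple if and only if the graph of nontrivial actions $\Gamma(B)$ contains a full oriented cycle, i.e. an oriented cycle that contains all vertices.
   Context: A left brace is a set $B$ with operations $+,\cdot$ such that $(B,+)$ is an abelian group, $(B,\cdot)$ is a group and $a\cdot(b+c)+a=a\cdot b+a\cdot c$ for all $a,b,c\in B$. Put $\lambda_a(b)=ab-a$; then $\lambda\colon(B,\cdot)\to\operatorname{Aut}(B,+)$ is a group homomorphism. A left ideal of $B$ is a subgroup $S$ of $(B,\cdot)$ with $\lambda_b(a)\in S$ for all $a\in S$, $b\in B$ (it is then also a left subbrace). An ideal of $B$ is a left ideal that is a normal subgroup of $(B,\cdot)$. A left brace $B$ is simple if it is nonzero and $\{0\}$ and $B$ are its only ideals. For $i\neq j$ let $\alpha^{(i,j)}\colon(B_i,\cdot)\to\operatorname{Aut}(B_j,+)$ be the homomorphism $\alpha^{(i,j)}_{a}(b)=\lambda_a(b)=ab-a$ for $a\in B_i$, $b\in B_j$. The graph $\Gamma(B)=(V,E)$ is the oriented graph with vertex set $V=\{1,\dots,s\}$ in which $(i,j)$ (with $i\ne j$) is an edge if and only if $\alpha^{(i,j)}$ is nontrivial. An oriented cycle here means a closed oriented path, in which vertices may be repeated. *)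

(* Defs.v *)
From HB Require Import structures.
From mathcomp Require Import all_boot fingroup ssralg.

Set Implicit Arguments.
Unset Strict Implicit.
Unset Printing Implicit Defensive.

Import GRing.Theory.
Local Open Scope group_scope.
Local Open Scope ring_scope.

Local Notation "x ** y" := (x * y)%g (at level 40, left associativity).

(* (B, +, 0) is the Zmodule structure and (B, .) the Group structure; [**] is *)
(* the group law, not the product of a ring.                                  *)
HB.mixin Record Group_Zmodule_isLeftBrace B
    of GRing.Zmodule B & monoid.Group B := {
  lbraceD : forall a b c : B, a ** (b + c) + a = a ** b + a ** c
}.

#[short(type="leftBraceType")]
HB.structure Definition LeftBrace :=
  {B of GRing.Zmodule B & monoid.Group B & Group_Zmodule_isLeftBrace B}.

#[short(type="finLeftBraceType")]
HB.structure Definition FinLeftBrace := {B of LeftBrace B & Finite B}.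

Definition lambda (B : leftBraceType) (a b : B) : B := a ** b - a.

Lemma lbrace1E (B : leftBraceType) : 1%g = 0 :> B.
Proof.
have := lbraceD (1%g : B) 0 0; rewrite !mul1g !addr0 add0r; exact.
Qed.

Section FinLeftBrace.

Variable B : finLeftBraceType.
Implicit Types S I : {group B}.

Definition left_subbrace S := {in S &, forall a b, a - b \in S}.

(* Ideals are defined relative to a left subbrace S; the ideals of B itself *)
(* are obtained for S = [set: B].                                             *)
Definition left_ideal S I :=
  I \subset S /\ {in S & I, forall b a, lambda b a \in I}.

Definition brace_ideal S I := left_ideal S I /\ I <| S.

Definition brace_simple S :=
  S != [set 0] :> {set B} /\
  forall I, brace_ideal S I -> I = [set 0] :> {set B} \/ I = S.

(* This ensures that [brace_simple I] is meaningful for I a left ideal of B.  *)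
Lemma left_ideal_subbrace I : left_ideal [set: B]%G I -> left_subbrace I.
Proof.
case=> _ lamI a b aI bI.
have oppI x : x \in I -> - x \in I.
  move=> xI; have := lamI x x^-1%g (in_setT _) (groupVr xI).
  by rewrite /lambda mulgV lbrace1E add0r.
have addI x y : x \in I -> y \in I -> x + y \in I.
  move=> xI yI; have -> : x + y = x ** lambda x^-1%g y.
    have := lbraceD x (x^-1 * y)%g (- x^-1%g).
    rewrite -/(lambda x^-1%g y) mulKVg => e.
    have := lbraceD x x^-1%g (- x^-1%g).
    rewrite subrr mulgV -lbrace1E mulg1 lbrace1E add0r => e'.
    have {}e' : x ** (- x^-1%g) = x + x by rewrite -e'.
    by apply: (addIr x); rewrite e e' addrA (addrC x y) -!addrA.
  by rewrite groupM // lamI ?inE // groupV.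
exact/addI/oppI.
Qed.

Variable s : nat.
Implicit Type Bs : 'I_s -> {group B}.

Definition inner_direct_sum Bs :=
  forall x : B, exists! f : {ffun 'I_s -> B},
    (forall i, f i \in Bs i) /\ x = \sum_i f i.

Definition action_graph Bs : rel 'I_s := fun i j =>
  (i != j) && [exists a in Bs i, [exists b in Bs j, lambda a b != b]].

Definition has_full_cycle (e : rel 'I_s) :=
  exists c : seq 'I_s, path.cycle e c /\ forall i, i \in c.

End FinLeftBrace.

(* Main.v *)
Require Import Defs.
From mathcomp Require Import all_boot fingroup ssralg.

(** The graph [action_graph Bs] has a full cycle exactly when it is strongly
    connected, so the theorem says that simplicity of the brace is strong
    connectedness of the graph. Two facts link the two notions. A left ideal
    [I] is an ideal if and only if the elements of [I] act trivially modulo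
    [I], that is, [lambda a b - b \in I] for [a \in I] and all [b]
    ([ideal_lambdaB], [lambdaB_ideal]). Moreover, the summands being of coprime
    orders, a nonzero left ideal meets some [Bs i] nontrivially
    ([left_ideal_meets_summand]): a suitable multiple of one of its elements
    keeps just one component.

    If the graph is strongly connected and [I] is a nonzero ideal, then [I]
    meets some [Bs i], and so contains it because [Bs i] is simple. An edge from
    [i] to [j] gives a nonzero element [lambda a b - b] of [Bs j] lying in [I],
    so [I] contains [Bs j] too ([ideal_edge]); following paths, [I] contains all
    the summands.

    If the graph is not strongly connected, let [C] be the set of vertices
    reachable from a vertex that does not reach all the others. No edge leaves
    [C], so the elements of [Bs i], for [i] in [C], act trivially modulo the sum
    of the [Bs j] with [j] in [C]. This sum is therefore an ideal
    ([partial_sum_ideal]), and it is neither zero nor the whole brace. *)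

Set Implicit Arguments.
Unset Strict Implicit.
Unset Printing Implicit Defensive.

Import GRing.Theory.

(** * Torsion in additive groups *)

Section Torsion.
Local Open Scope ring_scope.

Lemma mulrn_coprime0 (V : zmodType) (x : V) m n :
  coprime m n -> x *+ m = 0 -> x *+ n = 0 -> x = 0.
Proof.
move=> co_mn xm0 xn0; case: (posnP m) => [m0 | m_gt0].
  by move: co_mn; rewrite m0 /coprime gcd0n => /eqP n1; rewrite -xn0 n1.
case: (egcdnP n m_gt0) => u v Bezout _.
have: x *+ (u * m) = 0 by rewrite mulnC mulrnA xm0 mul0rn.
by rewrite Bezout (eqP co_mn) mulrnDr [(v * n)%N]mulnC mulrnA xn0 mul0rn add0r.
Qed.

End Torsion.

(** * Arithmetic of left braces *)

Section LeftBraceTheory.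
Local Open Scope ring_scope.
Variable B : leftBraceType.
Implicit Types a b c : B.

Lemma mul_lambda a b : (a * b)%g = a + lambda a b.
Proof. by rewrite /lambda addrC subrK. Qed.

Lemma lambdaD a b c : lambda a (b + c) = lambda a b + lambda a c.
Proof.
apply: (addrI a); apply: (addIr a); rewrite -mul_lambda lbraceD.
rewrite !mul_lambda; move: (lambda a b) (lambda a c) => u v.
by rewrite -!addrA [v + a]addrC.
Qed.

Lemma lambda0 a : lambda a 0 = 0.
Proof. by apply: (addrI (lambda a 0)); rewrite -lambdaD !addr0. Qed.

Lemma lambda_sum (I : Type) (r : seq I) (P : pred I) (F : I -> B) a :
  lambda a (\sum_(i <- r | P i) F i) = \sum_(i <- r | P i) lambda a (F i).
Proof. exact: (big_morph (lambda a) (lambdaD a) (lambda0 a)). Qed.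

Lemma lambda1 b : lambda 1%g b = b.
Proof. by rewrite /lambda mul1g lbrace1E subr0. Qed.

Lemma lambdaM a b c : lambda (a * b)%g c = lambda a (lambda b c).
Proof.
apply: (addrI (a * b)%g); rewrite -mul_lambda -mulgA.
rewrite (mul_lambda a (b * c)%g) (mul_lambda b c) (mul_lambda a b) lambdaD.
by move: (lambda a b) (lambda a _) => u v; rewrite addrA.
Qed.

Lemma addr_mul_lambdaV a b : a + b = (a * lambda a^-1%g b)%g.
Proof. by rewrite mul_lambda -lambdaM mulgV lambda1. Qed.

End LeftBraceTheory.

(** * Left ideals and ideals *)

Section LeftIdeals.
Local Open Scope ring_scope.
Variable B : finLeftBraceType.
Implicit Types I J : {group B}.

Lemma lambda_left_ideal I a b :
  left_ideal [set: B]%G I -> b \in I -> lambda a b \in I.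
Proof. by case=> _ lamI bI; apply: lamI; rewrite ?inE. Qed.

Lemma group0 I : 0 \in I.
Proof. by rewrite -lbrace1E group1. Qed.

Lemma exists_nonzero I :
  I != [set 0] :> {set B} -> exists2 x, x \in I & x != 0.
Proof.
move=> I_neq0; apply/exists_inP; apply: contraR I_neq0 => /exists_inPn I0.
rewrite eqEsubset sub1set group0 andbT; apply/subsetP => x xI.
by rewrite inE; apply: contraR (I0 x xI).
Qed.

Lemma left_idealB I a b :
  left_ideal [set: B]%G I -> a \in I -> b \in I -> a - b \in I.
Proof. by move=> /left_ideal_subbrace/[apply]/[apply]. Qed.

Lemma left_idealD I a b :
  left_ideal [set: B]%G I -> a \in I -> b \in I -> a + b \in I.
Proof.
move=> Il aI bI; rewrite -[b]opprK -[- b]add0r.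
by apply: left_idealB => //; apply: left_idealB (group0 I) bI.
Qed.

Lemma left_ideal_sum I (T : Type) (r : seq T) (P : pred T) (F : T -> B) :
    left_ideal [set: B]%G I -> (forall i, P i -> F i \in I) ->
  \sum_(i <- r | P i) F i \in I.
Proof.
move=> Il FI; apply: (big_ind (fun x => x \in I)) => //.
  exact: group0.
by move=> x y; apply: left_idealD.
Qed.

Lemma left_idealMn I a n :
  left_ideal [set: B]%G I -> a \in I -> a *+ n \in I.
Proof.
move=> Il aI; elim: n => [|n IHn]; first by rewrite mulr0n group0.
by rewrite mulrS left_idealD.
Qed.

(** Translation by [a] permutes [I], so the sum of the elements of [I] equals
    itself plus [a *+ #|I|]. *)
Lemma left_ideal_mulrn_card I a :
  left_ideal [set: B]%G I -> a \in I -> a *+ #|I| = 0.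
Proof.
move=> Il aI; have aDI x : (a + x \in I) = (x \in I).
  apply/idP/idP => [axI | ]; last exact: left_idealD.
  by rewrite -[x](addKr a) addrC left_idealB.
apply: (addIr (\sum_(x in I) x)); rewrite add0r.
rewrite [RHS](reindex_inj (addrI a)) /= (eq_bigl _ _ aDI).
by rewrite big_split /= sumr_const.
Qed.

(** [a * b] is [b * a ^ b], so normality of [I] puts [a * b] in the coset
    [b + I]. *)
Lemma ideal_lambdaB I a b :
  brace_ideal [set: B]%G I -> a \in I -> lambda a b - b \in I.
Proof.
move=> [Il nI] aI.
have ajI: (a ^ b)%g \in I by rewrite memJ_norm // (subsetP (normal_norm nI)) ?inE.
have -> : lambda a b - b = lambda b (a ^ b)%g - a.
  by rewrite /lambda -conjgC addrAC.
by apply: left_idealB => //; apply: lambda_left_ideal.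
Qed.

Lemma lambdaB_ideal I :
    left_ideal [set: B]%G I ->
    (forall a b, a \in I -> lambda a b - b \in I) ->
  brace_ideal [set: B]%G I.
Proof.
move=> Il trivI; split=> //; rewrite /normal subsetT /=.
apply/subsetP => b _; rewrite inE; apply/subsetP => _ /imsetP[a aI ->].
have -> : (a ^ b)%g = lambda b^-1%g (a + (lambda a b - b)).
  apply: (mulgI b); rewrite -addr_mul_lambdaV -conjgC mul_lambda.
  by move: (lambda a b) => u; rewrite addrCA [b + _]addrC subrK.
by apply: lambda_left_ideal => //; apply: left_idealD => //; apply: trivI.
Qed.

Lemma brace_ideal_setI I J :
    brace_ideal [set: B]%G I -> left_ideal [set: B]%G J ->
  brace_ideal J (I :&: J)%G.
Proof.
move=> [Il nI] Jl; split; first split.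
- exact: subsetIr.
- by move=> b a bJ /setIP[aI aJ]; rewrite inE !lambda_left_ideal.
- by rewrite /= setIC; apply: (normalGI (subsetT J) nI).
Qed.

(** The ideal [I :&: J] of the simple brace [J] is zero or [J]. *)
Lemma ideal_meets_simple I J x :
    brace_ideal [set: B]%G I -> left_ideal [set: B]%G J -> brace_simple J ->
    x \in I -> x \in J -> x != 0 ->
  J \subset I.
Proof.
move=> Ii Jl [_ simJ] xI xJ x_neq0.
case: (simJ _ (brace_ideal_setI Ii Jl)) => [IJ0 | <-]; last exact: subsetIl.
have: x \in [set 0] by rewrite -IJ0 inE xI.
by rewrite inE (negPf x_neq0).
Qed.

(** For [I] a left ideal, this is the kernel of the action of the group [B] on
    the additive quotient [B / I]. *)
Definition trivial_mod I : {set B} :=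
  [set a | [forall b, lambda a b - b \in I]].

Lemma trivial_mod_group_set I :
  left_ideal [set: B]%G I -> group_set (trivial_mod I).
Proof.
move=> Il; apply/group_setP; split=> [|a c].
  by rewrite inE; apply/forallP => b; rewrite lambda1 subrr group0.
rewrite !inE => /forallP aT /forallP cT; apply/forallP => b.
rewrite lambdaM -(subrK (lambda c b) (lambda a _)) -addrA.
exact: left_idealD.
Qed.

End LeftIdeals.

(** * Sums of left ideals *)

Section SumsOfLeftIdeals.
Local Open Scope ring_scope.
Variables (B : finLeftBraceType) (s : nat) (Bs : 'I_s -> {group B}).
Hypothesis Bs_left : forall i, left_ideal [set: B]%G (Bs i).
Implicit Types (C : {set 'I_s}) (K I : {group B}) (f : {ffun 'I_s -> B}).

(** Since [a + b = a * lambda a^-1 b], a sum over the left ideals can be turned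
    into a product of elements of the same left ideals. The family [f] varies
    in the induction because [lambda a^-1] moves the remaining terms. *)
Lemma sum_in_group K (r : seq 'I_s) (f : 'I_s -> B) :
    (forall i, f i \in Bs i) -> (forall i, i \in r -> Bs i \subset K) ->
  \sum_(i <- r) f i \in K.
Proof.
elim: r f => [|i r IHr] f fB rK; first by rewrite big_nil group0.
rewrite big_cons addr_mul_lambdaV lambda_sum groupM //.
  by rewrite (subsetP (rK i _)) ?mem_head.
apply: IHr => [j | j jr]; first exact: lambda_left_ideal.
by apply: rK; rewrite inE jr orbT.
Qed.

Definition partial_sum C : {set B} :=
  [set \sum_(i in C) (f : {ffun 'I_s -> B}) i | f in family (fun i => mem (Bs i))].

Lemma partial_sumP C x :
  reflect (exists2 f : 'I_s -> B,
             forall i, f i \in Bs i & x = \sum_(i in C) f i)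
          (x \in partial_sum C).
Proof.
apply: (iffP imsetP) => [[f /familyP fB ->] | [f fB ->]]; first by exists f.
exists (finfun f); first by apply/familyP => i; rewrite ffunE; apply: fB.
by apply: eq_bigr => i _; rewrite ffunE.
Qed.

Lemma partial_sumD C x y :
  x \in partial_sum C -> y \in partial_sum C -> x + y \in partial_sum C.
Proof.
move=> /partial_sumP[f fB ->] /partial_sumP[g gB ->].
apply/partial_sumP; exists (fun i => f i + g i); last by rewrite big_split.
by move=> i; apply: left_idealD.
Qed.

Lemma lambda_partial_sum C a x :
  x \in partial_sum C -> lambda a x \in partial_sum C.
Proof.
move=> /partial_sumP[f fB ->]; rewrite lambda_sum.
apply/partial_sumP; exists (fun i => lambda a (f i)) => // i.
exact: lambda_left_ideal.
Qed.

Lemma partial_sum_group_set C : group_set (partial_sum C).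
Proof.
apply/group_setP; split=> [|x y xS yS]; last first.
  by rewrite mul_lambda partial_sumD ?lambda_partial_sum.
apply/partial_sumP; exists (fun=> 0); first by move=> i; apply: group0.
by rewrite big1 // lbrace1E.
Qed.

Definition partial_sum_group C : {group B} := Group (partial_sum_group_set C).

Lemma left_ideal_partial_sum C : left_ideal [set: B]%G (partial_sum_group C).
Proof. by split=> [|b a _]; [apply: subsetT | apply: lambda_partial_sum]. Qed.

Lemma mem_partial_sum C i x : i \in C -> x \in Bs i -> x \in partial_sum C.
Proof.
move=> iC xB; apply/partial_sumP; exists (fun j => if j == i then x else 0).
  by move=> j; case: eqP => [-> | _] //; apply: group0.
rewrite (bigD1 i iC) eqxx big1 /= ?addr0 // => j /andP[_ jNi].
by rewrite (negPf jNi).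
Qed.

Hypothesis Bs_sum : inner_direct_sum Bs.

Lemma partial_sum_disjoint C i x :
  i \notin C -> x \in Bs i -> x \in partial_sum C -> x = 0.
Proof.
move=> iNC xB /partial_sumP[f fB def_x].
pose g := [ffun j => if j == i then x else 0] : {ffun 'I_s -> B}.
pose h := [ffun j => if j \in C then f j else 0] : {ffun 'I_s -> B}.
have [u [_ u_uniq]] := Bs_sum x.
have -> : x = g i by rewrite ffunE eqxx.
have <- : h i = 0 by rewrite ffunE (negPf iNC).
suff [<- <-] : u = g /\ u = h by [].
split; apply: u_uniq; split=> [j|].
- by rewrite ffunE; case: eqP => [-> | _] //; apply: group0.
- rewrite (bigD1 i) //= ffunE eqxx big1 ?addr0 // => j jNi.
  by rewrite ffunE (negPf jNi).
- by rewrite ffunE; case: ifP => // _; apply: group0.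
- by rewrite def_x big_mkcond; apply: eq_bigr => j _; rewrite ffunE.
Qed.

(** The product of the orders of the other summands is an exponent that kills
    every component of an element of [I] but one, chosen to be nonzero; by
    coprimality it does not kill that one. *)
Lemma left_ideal_meets_summand I :
    (forall i j, i != j -> coprime #|Bs i| #|Bs j|) ->
    left_ideal [set: B]%G I -> I != [set 0] :> {set B} ->
  exists i x, [/\ x \in I, x \in Bs i & x != 0].
Proof.
move=> Bs_co Il I_neq0.
have [x xI x_neq0] := exists_nonzero I_neq0.
have [f [[fB def_x] _]] := Bs_sum x.
have [i fi_neq0] : exists i, f i != 0.
  apply/existsP; apply: contraR x_neq0 => /existsPn f0.
  by rewrite def_x big1 // => i _; apply/eqP; rewrite -[_ == _]negbK f0.
pose n := (\prod_(j | j != i) #|Bs j|)%N.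
have xn : x *+ n = f i *+ n.
  rewrite def_x -sumrMnl (bigD1 i) //= big1 ?addr0 // => j jNi.
  by rewrite /n (bigD1 j) //= mulrnA left_ideal_mulrn_card ?mul0rn.
exists i, (x *+ n); rewrite left_idealMn // xn left_idealMn //; split=> //.
apply: contraNneq fi_neq0 => fin0; apply/eqP.
apply: (@mulrn_coprime0 _ _ #|Bs i| n) => //; last exact: left_ideal_mulrn_card.
apply: (big_ind (coprime #|Bs i|)); first exact: coprimen1.
  by move=> p q; rewrite coprimeMr => -> ->.
by move=> j; rewrite eq_sym; apply: Bs_co.
Qed.

(** For [a] in [Bs i] with [i] in [C], the components of [lambda a b - b]
    outside [C] vanish, as no edge leaves [C]. Being multiplicative, the set of
    elements acting trivially then contains the sum of these [Bs i]. *)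
Lemma partial_sum_ideal C :
    (forall i j, action_graph Bs i j -> i \in C -> j \in C) ->
  brace_ideal [set: B]%G (partial_sum_group C).
Proof.
move=> C_closed; have Sl := left_ideal_partial_sum C.
apply: lambdaB_ideal => // a b /partial_sumP[g gB ->].
suff: \sum_(i in C) g i \in Group (trivial_mod_group_set Sl).
  by rewrite inE => /forallP.
rewrite -big_enum; apply: (@sum_in_group (Group _) _ g) => // i; rewrite mem_enum => iC.
apply/subsetP => {b} c cB; rewrite inE; apply/forallP => b.
have [f [[fB ->] _]] := Bs_sum b.
rewrite lambda_sum -sumrB; apply: left_ideal_sum => // j _.
have [jC | jNC] := boolP (j \in C).
  apply: mem_partial_sum jC _.
  by apply: left_idealB => //; apply: lambda_left_ideal.
suff -> : lambda c (f j) = f j by rewrite subrr group0.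
apply/eqP; apply: contraNT (jNC) => lam_neq; apply: (C_closed i j) (iC).
apply/andP; split; last first.
  by apply/exists_inP; exists c => //; apply/exists_inP; exists (f j).
by apply: contraNneq jNC => <-.
Qed.

Lemma ideal_edge I i j :
    brace_ideal [set: B]%G I -> brace_simple (Bs j) ->
    action_graph Bs i j -> Bs i \subset I -> Bs j \subset I.
Proof.
move=> Ii simj /andP[_ /exists_inP[a aB /exists_inP[b bB lam_neq]]] /subsetP iI.
apply: (@ideal_meets_simple _ I (Bs j) (lambda a b - b)) => //.
- by apply: ideal_lambdaB => //; apply: iI.
- by apply: left_idealB => //; apply: lambda_left_ideal.
- by rewrite subr_eq0.
Qed.

End SumsOfLeftIdeals.

(** * Full cycles and strong connectedness *)

Section FullCycles.
Variables (s : nat) (e : rel 'I_s).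

Lemma walk_through (x : 'I_s) (r : seq 'I_s) :
    (forall i j, connect e i j) ->
  forall y, exists p, [/\ path e y p, last y p = x & {subset r <= y :: p}].
Proof.
move=> e_conn; elim: r => [|z r IHr] y.
  by have /connectP[p e_p ->] := e_conn y x; exists p.
have /connectP[p e_p def_z] := e_conn y z; have [q [e_q q_x r_q]] := IHr z.
exists (p ++ q); rewrite cat_path e_p last_cat -def_z; split=> // i.
have zyp: z \in y :: p by rewrite def_z mem_last.
rewrite -cat_cons mem_cat inE => /predU1P[-> | /r_q]; first by rewrite zyp.
by rewrite inE => /predU1P[-> | ->]; rewrite ?zyp ?orbT.
Qed.

Lemma full_cycleP :
  1 < s -> has_full_cycle e <-> forall i j, connect e i j.
Proof.
move=> s_gt1; split=> [[c [e_c c_all]] i j | e_conn].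
  exact: connect_cycle e_c _ _ (c_all i) (c_all j).
pose x := Ordinal (ltnW s_gt1).
have [p [e_p p_x p_all]] := walk_through x (enum 'I_s) e_conn x.
case: (lastP p) => [|q y] in e_p p_x p_all *.
  (* A closed walk of length zero visits [x] only. *)
  have := p_all (Ordinal s_gt1) (mem_enum _ _).
  by rewrite inE.
rewrite last_rcons in p_x; rewrite {y}p_x in e_p p_all.
exists (x :: q); split=> // i; have := p_all i (mem_enum _ _).
by rewrite !inE mem_rcons inE; case: (i == x).
Qed.

End FullCycles.

(** * Simplicity and strong connectedness *)

Theorem theorem2p6 (B : finLeftBraceType) (s : nat) (hs : 2 <= s)
    (Bs : 'I_s -> {group B})
    (hleft : forall i, left_ideal [set: B]%G (Bs i))
    (hcoprime : forall i j, i != j -> coprime #|Bs i| #|Bs j|)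
    (hsum : inner_direct_sum Bs)
    (hsimple : forall i, brace_simple (Bs i)) :
  brace_simple [set: B]%G <-> has_full_cycle (action_graph Bs).
Proof.
have nz_Bs i := exists_nonzero (proj1 (hsimple i)).
apply: iff_trans (iff_sym (full_cycleP _ hs)); split=> [[_ simB] i j | e_conn].
  pose C := [set k | connect (action_graph Bs) i k].
  have C_closed k l : action_graph Bs k l -> k \in C -> l \in C.
    by rewrite !inE => e_kl c_ik; apply: connect_trans c_ik (connect1 e_kl).
  case: (simB _ (partial_sum_ideal hleft hsum C_closed)) => [/= S0 | ST].
    have [x xB x_neq0] := nz_Bs i.
    have: x \in partial_sum Bs C by apply: mem_partial_sum xB; rewrite inE.
    by rewrite S0 inE (negPf x_neq0).
  have [x xB] := nz_Bs j; apply: contraNT => c_ij; apply/eqP.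
  apply: (@partial_sum_disjoint _ _ _ hsum C j) => //; first by rewrite inE.
  have: x \in partial_sum_group hleft C by rewrite ST inE.
  by [].
have [i0 _] : exists i0 : 'I_s, true by exists (Ordinal (ltnW hs)).
split=> [|I Ii].
  have [x _] := nz_Bs i0; apply: contraNneq => BT.
  by rewrite -in_set1 -BT inE.
have [I0 | I_neq0] := eqVneq (I : {set B}) [set 0%R]; first by left.
right; have Il := proj1 Ii.
have [i [x [xI xB x_neq0]]] :=
  left_ideal_meets_summand hleft hsum hcoprime Il I_neq0.
have iI := ideal_meets_simple Ii (hleft i) (hsimple i) xI xB x_neq0.
have allI j : Bs j \subset I.
  have /connectP[p e_p ->] := e_conn i j.
  elim: p i iI e_p {x xB xI x_neq0} => //= k p IHp i iI /andP[e_ik].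
  by apply: IHp; apply: ideal_edge e_ik iI.
apply/val_inj/eqP; rewrite eqEsubset subsetT; apply/subsetP => y _.
have [f [[fB ->] _]] := hsum y.
by apply: left_ideal_sum => // j _; apply: (subsetP (allI j)).
Qed.
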